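(* Let $x=(x_1,\dots,x_n)\in S(A,b)$. Then $x\in\check S(A,b)$ if and only if $x_j=\delta_j(x)$ for every $j\in J$.
   Context: Let $I=\{1,\dots,m\}$, $J=\{1,\dots,n\}$, $A=(a_{ij})_{m\times n}$ with $a_{ij}\in[0,1]$, and $b=(b_1,\dots,b_m)$ with $b_i>0$ real. The Łukasiewicz t-norm is $T_L(a,x)=\max\{a+x-1,0\}$ on $[0,1]^2$. The solution set is $S(A,b)=\{x\in[0,1]^n : \sum_{j\in J}T_L(a_{ij},x_j)\ge b_i \text{ for all } i\in I\}$. Vectors are ordered componentwise. A solution $\check x\in S(A,b)$ is minimal if $x\in S(A,b)$ and $x\le\check x$ imply $x=\check x$; $\check S(A,b)$ is the set of all minimal solutions. For $x\in S(A,b)$ and $j\in J$, define $F_j(x)=\{t\in[0,1] : T_L(a_{ij},t)+\sum_{k\in J\setminus\{j\}}T_L(a_{ik},x_k)\ge b_i \text{ for all } i\in I\}$ and $\delta_j(x)=\min F_j(x)$. *)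

(* Defs.v *)
From mathcomp Require Import all_boot all_order all_algebra.
From mathcomp Require Import boolp classical_sets reals.

Set Implicit Arguments.
Unset Strict Implicit.
Unset Printing Implicit Defensive.

Import Order.TTheory GRing.Theory Num.Theory.

Local Open Scope classical_set_scope.
Local Open Scope ring_scope.

(* The Lukasiewicz t-norm; only its values on [0,1]^2 are meaningful. *)
Definition TL {R : realType} (a x : R) : R := Num.max (a + x - 1) 0.

Definition le_vec {R : realType} {n : nat} (x y : 'rV[R]_n) : Prop :=
  forall j, x 0 j <= y 0 j.

Definition sol_set {R : realType} {m n : nat} (A : 'M[R]_(m, n))
    (b : 'rV[R]_m) : set 'rV[R]_n :=
  [set x | (forall j, 0 <= x 0 j <= 1) /\
           forall i, b 0 i <= \sum_j TL (A i j) (x 0 j)].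

Definition min_sol_set {R : realType} {m n : nat} (A : 'M[R]_(m, n))
    (b : 'rV[R]_m) : set 'rV[R]_n :=
  [set x | sol_set A b x /\
           forall y, sol_set A b y -> le_vec y x -> y = x].

Definition feas_coord {R : realType} {m n : nat} (A : 'M[R]_(m, n))
    (b : 'rV[R]_m) (j : 'I_n) (x : 'rV[R]_n) : set R :=
  [set t | 0 <= t <= 1 /\
           forall i, b 0 i <= TL (A i j) t + \sum_(k | k != j) TL (A i k) (x 0 k)].

(* [set_min E] is the least element of [E], not its infimum; it takes the junk
   value 0 when [E] has no least element. *)
Definition set_min {R : realType} (E : set R) : R := xget 0 (E `&` lbound E).

Definition delta {R : realType} {m n : nat} (A : 'M[R]_(m, n))
    (b : 'rV[R]_m) (j : 'I_n) (x : 'rV[R]_n) : R :=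
  set_min (feas_coord A b j x).

(* Main.v *)
(* A solution [x] satisfies [x_j \in F_j(x)] for every [j], and [x] is minimal
   exactly when each [x_j] is a lower bound of [F_j(x)]: lowering a single
   coordinate within [F_j(x)] gives a smaller solution, and conversely a solution
   [y <= x] has [y_j \in F_j(x)] because [T_L] is monotone. *)
Require Import Defs.
From mathcomp Require Import all_boot all_order all_algebra.
From mathcomp Require Import boolp classical_sets reals.

Import Order.TTheory GRing.Theory Num.Theory.

Local Open Scope classical_set_scope.
Local Open Scope ring_scope.

Lemma TL_le {R : realType} (a : R) {x y : R} : x <= y -> TL a x <= TL a y.
Proof.
move=> xy; rewrite /TL ge_max !le_max lexx orbT andbT.
by rewrite lerD2r lerD2l xy.
Qed.

Lemma set_min_eq {R : realType} (E : set R) (u : R) :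
  E u -> lbound E u -> set_min E = u.
Proof.
move=> Eu lbu; apply: xget_unique; first by split.
by move=> v [Ev lbv]; apply/le_anti; rewrite lbv // lbu.
Qed.

(* The hypothesis [lbound E 0] makes the junk value of [set_min] a lower bound. *)
Lemma set_min_lbound {R : realType} (E : set R) :
  lbound E 0 -> lbound E (set_min E).
Proof. by move=> lb0; rewrite /set_min; case: xgetP => [v _ []|]. Qed.

Definition set_coord {R : realType} {n : nat} (x : 'rV[R]_n) (j : 'I_n) (t : R)
  : 'rV[R]_n := \row_k if k == j then t else x 0 k.

Section Coordinates.
Context {R : realType} {m n : nat} {A : 'M[R]_(m, n)} {b : 'rV[R]_m}.
Implicit Types x y : 'rV[R]_n.

Lemma lbound_feas_coord0 x (j : 'I_n) : lbound (feas_coord A b j x) 0.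
Proof. by move=> t [/andP[]]. Qed.

(** The [j]-th term stays that of [y], and every other term can only grow when [y] is replaced by
    [x]. *)
Lemma feas_coord_le {x y} (j : 'I_n) :
  sol_set A b y -> le_vec y x -> feas_coord A b j x (y 0 j).
Proof.
move=> [y01 yb] yx; split=> // i; apply: le_trans (yb i) _.
by rewrite (bigD1 j) //= lerD2l; apply: ler_sum => k _; apply: TL_le.
Qed.

Lemma sol_set_coord {x} {j : 'I_n} {t : R} :
  sol_set A b x -> feas_coord A b j x t -> sol_set A b (set_coord x j t).
Proof.
move=> [x01 _] [t01 tb]; split=> [k|i]; first by rewrite mxE; case: eqP.
rewrite (bigD1 j) //= mxE eqxx; apply: le_trans (tb i) _.
by rewrite lerD2l; apply: ler_sum => k /negbTE kj; rewrite mxE kj.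
Qed.

(** Speaking of lower bounds rather than minima avoids a separate proof that F_j(x) has a least
    element. *)
Lemma min_sol_set_lbound x : sol_set A b x ->
  min_sol_set A b x <-> forall j, lbound (feas_coord A b j x) (x 0 j).
Proof.
move=> xS; split=> [[_ xmin] j t Ft | lbx].
- rewrite leNgt; apply/negP => tx.
  have le_x : le_vec (set_coord x j t) x.
    by move=> k; rewrite mxE; case: eqP => // ->; apply: ltW.
  (* Minimality forces the lowered vector to equal [x]; entry [j] then reads [t = x 0 j], against
     [t < x 0 j]. *)
  have /matrixP/(_ 0 j) := xmin _ (sol_set_coord xS Ft) le_x.
  by rewrite mxE eqxx => tE; rewrite tE ltxx in tx.
- split=> // y yS yx; apply/rowP => j; apply/le_anti.
  by rewrite yx lbx //; apply: feas_coord_le.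
Qed.

End Coordinates.

Theorem theorem4p1 (R : realType) (m n : nat) (A : 'M[R]_(m, n))
    (b : 'rV[R]_m)
    (hA : forall i j, 0 <= A i j <= 1)
    (hb : forall i, 0 < b 0 i)
    (x : 'rV[R]_n) (hx : sol_set A b x) :
  min_sol_set A b x <-> (forall j : 'I_n, x 0 j = delta A b j x).
Proof.
(* This is the case [y = x] of [feas_coord_le]. *)
have xF j : feas_coord A b j x (x 0 j) by apply: feas_coord_le => // k.
apply: (iff_trans (min_sol_set_lbound _ hx)); split=> [lbx j | xd j].
  by rewrite /delta (set_min_eq _ _ (xF j) (lbx j)).
(* Even the default value 0 of [delta] would bound F_j(x) below, since F_j(x) lies in [0,1]. *)
by rewrite xd; apply: set_min_lbound; apply: lbound_feas_coord0.
Qed.
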